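(* Let $d\ge 6$ be an integer and let $\alpha,\beta$ be real numbers. Let $\mathbf{T}_d(\alpha,\beta)$ be the $d\times d$ symmetric Toeplitz matrix whose $(i,j)$ entry equals $1$ if $i=j$, $\alpha$ if $|i-j|=1$, $\beta$ if $|i-j|=2$, and $0$ if $|i-j|\ge 3$. Then $\mathbf{T}_d(\alpha,\beta)\in\mathcal{T}_d$ if and only if $$\alpha\ge 0,\quad \beta\ge 0,\quad \alpha+4\beta\le 2,\quad 2\alpha-\beta\le 1.$$
   Context: For a random vector $(X_1,X_2)$ with continuous marginal distribution functions $F_1,F_2$, the (lower) tail dependence coefficient is $\chi(X_1,X_2)=\lim_{u\downarrow 0}\Pr(F_1(X_1)\le u,\,F_2(X_2)\le u)/u$, provided the limit exists. A $d$-dimensional tail dependence matrix (TDM) is a matrix of the form $(\chi(X_i,X_j))_{1\le i,j\le d}$ for some $d$-dimensional random vector $(X_1,\dots,X_d)$ with continuous marginals for which all these limits exist. $\mathcal{T}_d$ is the set of all $d$-dimensional TDMs. *)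

(* Defs.v *)
From mathcomp Require Import all_boot all_order all_algebra.
From mathcomp Require Import all_classical all_reals all_analysis.

Set Implicit Arguments.
Unset Strict Implicit.
Unset Printing Implicit Defensive.

Import Order.TTheory GRing.Theory Num.Theory.
Import numFieldNormedType.Exports.

Local Open Scope classical_set_scope.
Local Open Scope ring_scope.

Definition tail_ratio (disp : measure_display) (T : measurableType disp)
    (R : realType) (P : probability T R) (X Y : {RV P >-> R}) (u : R) : R :=
  fine (P [set w | (cdf X (X w) <= u%:E)%E /\ (cdf Y (Y w) <= u%:E)%E]) / u.

(* Stated as a relation: the limit chi(X, Y) exists and is equal to c. *)
Definition tail_dependence (disp : measure_display) (T : measurableType disp)
    (R : realType) (P : probability T R) (X Y : {RV P >-> R}) (c : R) : Prop :=
  tail_ratio X Y u @[u --> 0^'+] --> c.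

Definition TDM (R : realType) (d : nat) : set 'M[R]_d :=
  [set M : 'M[R]_d | exists (disp : measure_display) (T : measurableType disp)
             (P : probability T R) (X : 'I_d -> {RV P >-> R}),
           (forall i, continuous (cdf (X i))) /\
           (forall i j, tail_dependence (X i) (X j) (M i j))].

Definition toeplitz (R : realType) (d : nat) (alpha beta : R) : 'M[R]_d :=
  \matrix_(i, j) match `|i%:Z - j%:Z|%N with
                 | 0 => 1
                 | 1 => alpha
                 | 2 => beta
                 | _ => 0
                 end.

(* Main.v *)
From HB Require Import structures.
Require Import Defs.
From mathcomp Require Import all_boot all_order all_algebra.
From mathcomp Require Import all_classical all_reals all_analysis.
From mathcomp Require Import ring lra zify measurable_realfun.

Set Implicit Arguments.
Unset Strict Implicit.
Unset Printing Implicit Defensive.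

Import Order.TTheory GRing.Theory Num.Theory.
Import numFieldNormedType.Exports.

Local Open Scope classical_set_scope.
Local Open Scope ring_scope.

(** Tail dependence matrices behave like the matrices [w 1_S 1_S^T] summed over
    subsets [S] of the index set, and both directions exploit this.

    Necessity is linear duality.  If a quadratic form [sum c_kl b_k b_l] is
    nonnegative on all 0/1 vectors [b], evaluate it at the indicators of the
    tail events [F_k(X_k) <= u], take expectations, divide by [u] and let [u]
    tend to 0: the same combination of the entries of the matrix is
    nonnegative ([TDM_linear_ge0]).  The two interesting bounds come from two
    such forms.  One is [b1 + b0 b2 - b0 b1 - b1 b2], which is
    [(1 - b0)(1 - b2)] when [b1 = 1]; it gives [2 alpha - beta <= 1].  The
    other lives on six consecutive indices: it is
    [b2 + b3 - b2 b3 - b0 b2 - b1 b3 - b2 b4 - b3 b5] plus [b_k b_l] for every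
    pair at distance at least 3.  The added pairs make it nonnegative while
    contributing nothing on the Toeplitz matrix, so that it gives
    [alpha + 4 beta <= 2].

    For sufficiency, any combination of matrices [1_S 1_S^T] with nonnegative
    weights and unit diagonal is a tail dependence matrix
    ([TDM_of_weighted_sets]): draw [S] with probability proportional to its
    weight, draw an independent uniform [U], and let [X_i] be [U] if [i] is
    in [S] and [U + 1] otherwise.  Only the [X_i] with [i] in [S] can be in
    their lower tail, and they then are equal.  To write the Toeplitz matrix
    in this way, use all the translates of [{1}], [{1,2}], [{1,3}] and
    [{1,2,3}], with weights [s], [p], [q] and [t].  The entries are then
    [s + 2p + 2q + 3t = 1], [p + 2t = alpha] and [q + t = beta], and the four
    inequalities say exactly that some [t >= 0] makes [s], [p], [q]
    nonnegative ([toeplitz_TDM]). *)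

(** * Linear inequalities satisfied by tail dependence matrices *)

(** The combination of probabilities is the expectation of the form evaluated
    at the random 0/1 vector of the indicators of the events [A i]. *)
Lemma sum_probability_ge0 (disp : measure_display) (T : measurableType disp)
    (R : realType) (P : probability T R) (I : Type) (A : I -> set T)
    (s : seq (R * (I * I))) :
  (forall i, measurable (A i)) ->
  (forall b : I -> bool,
    0 <= \sum_(x <- s) x.1 * (b x.2.1 && b x.2.2)%:R) ->
  0 <= \sum_(x <- s) x.1 * fine (P (A x.2.1 `&` A x.2.2)).
Proof.
move=> mA s_ge0.
pose f x w : R := x.1 * \1_(A x.2.1 `&` A x.2.2) w.
have intI B : measurable B -> P.-integrable setT (EFin \o (\1_B : T -> R)).
  by move=> mB; exact: integrable_indic.
have mAI x : measurable (A x.2.1 `&` A x.2.2) by exact: measurableI.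
have [_ ->] : P.-integrable setT (EFin \o (fun w => \sum_(x <- s) f x w)) /\
    \sum_(x <- s) x.1 * fine (P (A x.2.1 `&` A x.2.2)) =
    \int[P]_w (\sum_(x <- s) f x w).
  elim: (s) => [|x r [int_r IHr]].
    split.
      by under eq_fun do rewrite big_nil; exact: integrable0.
    rewrite big_nil; under eq_Rintegral do rewrite big_nil.
    by rewrite Rintegral_cst// mul0r.
  have int_x : P.-integrable setT (EFin \o f x).
    rewrite (_ : _ \o _ =
      fun w => (x.1%:E * (\1_(A x.2.1 `&` A x.2.2) w)%:E)%E)//.
    by apply: integrableZl => //; exact: intI.
  split.
    under eq_fun do rewrite big_cons.
    exact: (integrableD measurableT int_x int_r).
  rewrite big_cons; under eq_Rintegral do rewrite big_cons.
  rewrite RintegralD// IHr; congr +%R.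
  rewrite RintegralZl//; last exact: intI.
  by rewrite /Rintegral integral_indic// setIT.
apply: Rintegral_ge0 => w _.
under eq_bigr do rewrite /f indicE in_setI.
exact: (s_ge0 (fun i => w \in A i)).
Qed.

(** Quadratic forms are given by lists of terms [(c, (i, j))], so that a
    concrete form with few terms unfolds by computation. *)
Lemma TDM_linear_ge0 (R : realType) (d : nat) (M : 'M[R]_d)
    (s : seq (R * ('I_d * 'I_d))) :
  (forall b : 'I_d -> bool,
    0 <= \sum_(x <- s) x.1 * (b x.2.1 && b x.2.2)%:R) ->
  TDM M -> 0 <= \sum_(x <- s) x.1 * M x.2.1 x.2.2.
Proof.
move=> s_ge0 [disp [T [P [X [_ XM]]]]].
pose ratio u := \sum_(x <- s) x.1 * tail_ratio (X x.2.1) (X x.2.2) u.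
have ratio_cvg : ratio u @[u --> 0^'+] --> \sum_(x <- s) x.1 * M x.2.1 x.2.2.
  apply: cvg_big => [|x _]; first by move=> x; exact: add_continuous.
  by apply: cvgMl_tmp; exact: XM.
apply: (closed_cvg (fun y : R => 0 <= y)) ratio_cvg; first exact: closed_ge.
near=> u.
pose A i := [set w | (cdf (X i) (X i w) <= u%:E)%E].
have mA i : measurable (A i).
  rewrite -[A i]setTI; apply: emeasurable_fun_infty_c => //.
  by apply: measurableT_comp; [exact: cdf_measurable | exact: measurable_funPT].
have -> : ratio u =
    u^-1 * \sum_(x <- s) x.1 * fine (P (A x.2.1 `&` A x.2.2)).
  rewrite /ratio mulr_sumr; apply: eq_bigr => x _.
  by rewrite [RHS]mulrCA; congr (_ * _); rewrite mulrC.
by rewrite mulr_ge0// ?invr_ge0// sum_probability_ge0.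
Unshelve. all: by end_near. Qed.

Lemma toeplitzE (R : realType) (d : nat) (alpha beta : R) (i j : 'I_d) :
  (i <= j)%N ->
  toeplitz d alpha beta i j =
    match (j - i)%N with 0 => 1 | 1 => alpha | 2 => beta | _ => 0 end.
Proof. by move=> ij; rewrite mxE distnEr. Qed.

Lemma toeplitz_sym (R : realType) (d : nat) (alpha beta : R) (i j : 'I_d) :
  toeplitz d alpha beta i j = toeplitz d alpha beta j i.
Proof. by rewrite !mxE distnC. Qed.

(** Each bound comes from a form in the first six variables only, so that its
    nonnegativity on 0/1 vectors is a finite check. *)
Lemma TDM_toeplitz_bounds (R : realType) (d : nat) (alpha beta : R) :
  (6 <= d)%N -> TDM (toeplitz d alpha beta) ->
  [/\ 0 <= alpha, 0 <= beta, alpha + 4 * beta <= 2 & 2 * alpha - beta <= 1].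
Proof.
case: d => [//|d] d6 TM.
pose e k : 'I_d.+1 := inord k.
have eE k : (k < 6)%N -> e k = k :> nat.
  by move=> k6; rewrite inordK// (leq_trans k6).
have tE k l : (k <= l < 6)%N -> toeplitz d.+1 alpha beta (e k) (e l) =
    match (l - k)%N with 0 => 1 | 1 => alpha | 2 => beta | _ => 0 end.
  move=> /andP[kl l6]; have k6 := leq_ltn_trans kl l6.
  by rewrite toeplitzE ?eE.
split.
- have := @TDM_linear_ge0 R _ _ [:: (1, (e 0, e 1))] _ TM.
  rewrite big_seq1 /= mul1r tE//; apply=> b.
  by rewrite big_seq1 /= mul1r.
- have := @TDM_linear_ge0 R _ _ [:: (1, (e 0, e 2))] _ TM.
  rewrite big_seq1 /= mul1r tE//; apply=> b.
  by rewrite big_seq1 /= mul1r.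
(* The negative terms use one pair at distance 1 and all four pairs at distance
   2; the last six terms are the pairs at distance at least 3. *)
- have := @TDM_linear_ge0 R _ _ [::
    (1, (e 2, e 2)); (1, (e 3, e 3)); (-1, (e 2, e 3));
    (-1, (e 0, e 2)); (-1, (e 1, e 3)); (-1, (e 2, e 4)); (-1, (e 3, e 5));
    (1, (e 0, e 3)); (1, (e 0, e 4)); (1, (e 0, e 5));
    (1, (e 1, e 4)); (1, (e 1, e 5)); (1, (e 2, e 5))] _ TM.
  rewrite !big_cons big_nil /= !tE//= => H.
  suff: 0 <= 2 - alpha - 4 * beta by lra.
  apply: le_trans (H _) _; last by lra.
  move=> b; rewrite !big_cons big_nil /=.
  by case: (b (e 0)); case: (b (e 1)); case: (b (e 2)); case: (b (e 3));
    case: (b (e 4)); case: (b (e 5)) => /=; lra.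
- have := @TDM_linear_ge0 R _ _ [::
    (1, (e 1, e 1)); (1, (e 0, e 2)); (-1, (e 0, e 1)); (-1, (e 1, e 2))] _ TM.
  rewrite !big_cons big_nil /= !tE//= => H.
  suff: 0 <= 1 + beta - 2 * alpha by lra.
  apply: le_trans (H _) _; last by lra.
  move=> b; rewrite !big_cons big_nil /=.
  by case: (b (e 0)); case: (b (e 1)); case: (b (e 2)) => /=; lra.
Qed.

(** * The uniform distribution on the unit interval *)

Section clamp.
Variable R : realType.
Implicit Types x y : R.

(** This is both the distribution function of the uniform law on [[0, 1]] and
    a version of the identity random variable with all its values in
    [[0, 1]]. *)
Definition clamp x : R := Num.max 0 (Num.min 1 x).

Lemma clamp_id x : 0 <= x <= 1 -> clamp x = x.
Proof. by move=> /andP[x0 x1]; rewrite /clamp min_r// max_r. Qed.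

Lemma clamp_le0 x : x <= 0 -> clamp x = 0.
Proof. by move=> x0; rewrite /clamp min_r ?max_l// (le_trans x0). Qed.

Lemma clamp_ge1 x : 1 <= x -> clamp x = 1.
Proof. by move=> x1; rewrite /clamp min_l ?max_r. Qed.

Lemma clamp_itv x : 0 <= clamp x <= 1.
Proof. by rewrite /clamp le_max lexx/= ge_max ler01/= ge_min lexx. Qed.

Lemma continuous_clamp : continuous clamp.
Proof.
move=> x; apply: continuous_max; first exact: cvg_cst.
by apply: continuous_min; [exact: cvg_cst | exact: cvg_id].
Qed.

Lemma measurable_clamp : measurable_fun [set: measurableTypeR R] clamp.
Proof. exact: continuous_measurable_fun continuous_clamp. Qed.

Lemma measurable_clamp_le y :
  measurable ([set v | clamp v <= y] : set (measurableTypeR R)).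
Proof.
rewrite [X in measurable X](_ : _ = setT `&` clamp @^-1` `]-oo, y]).
  exact: measurable_clamp.
by rewrite setTI; apply/seteqP; split=> v /=; rewrite in_itv.
Qed.

Lemma uniform01_ray x : uniform_prob (@ltr01 R) `]-oo, x] = (clamp x)%:E.
Proof.
rewrite /uniform_prob integral_uniform_pdf.
rewrite (eq_integral (cst 1%E)); last first.
  move=> y /[!inE] -[_ /=]; rewrite in_itv/= => y01.
  by rewrite /uniform_pdf y01 subr0 invr1.
rewrite integral_cst//= ?mul1e; last exact: measurableI.
have -> : `]-oo, x] `&` `[0, 1] = [set` `[0, Num.min 1 x]] :> set R.
  apply/seteqP; split=> y /=; rewrite !in_itv/= le_min.
    by move=> [-> /andP[-> ->]].
  by move=> /and3P[-> -> ->].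
rewrite lebesgue_measure_itv/= lte_fin /clamp oppr0 adde0.
by case: ltP => _; rewrite ?subr0 ?oppr0 ?adde0.
Qed.

Lemma uniform01_clamp x :
  uniform_prob (@ltr01 R) [set y | clamp y <= x] = (clamp x)%:E.
Proof.
have [x0|x0] := ltP x 0.
  rewrite clamp_le0 ?ltW// [X in uniform_prob _ X](_ : _ = set0) ?measure0//.
  apply/seteqP; split=> y //=; have /andP[y0 _] := clamp_itv y.
  by rewrite leNgt (lt_le_trans x0).
have [x1|x1] := leP 1 x.
  rewrite clamp_ge1// [X in uniform_prob _ X](_ : _ = setT) ?probability_setT//.
  apply/seteqP; split=> y //= _; have /andP[_ y1] := clamp_itv y.
  exact: le_trans x1.
rewrite -uniform01_ray; congr (uniform_prob _ _).
apply/seteqP; split=> y /=; rewrite in_itv/= /clamp ge_max x0 ge_min.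
  by rewrite leNgt x1.
by move=> ->; rewrite orbT.
Qed.

End clamp.

(** * Random vectors built from a random set *)

Section shifted_clamp.
Variables (R : realType) (K : set nat).

(** A point [(k, v)] carries the index [k] of the random set and an independent
    uniform value [v]; [K] is the set of those [k] whose set contains the
    coordinate under consideration.  Off [K] the value is pushed into
    [[1, 2]], away from the lower tail. *)
Definition shifted_clamp (x : nat * measurableTypeR R) : R :=
  clamp x.2 + (x.1 \notin K)%:R.

Lemma measurable_shifted_clamp : measurable_fun setT shifted_clamp.
Proof.
apply: measurable_funD.
  exact: measurableT_comp (@measurable_clamp R) measurable_snd.
by apply: (measurableT_comp (f := fun k : nat => (k \notin K)%:R : R)).
Qed.

HB.instance Definition _ :=
  isMeasurableFun.Build _ _ _ _ shifted_clamp measurable_shifted_clamp.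

Variable Q : probability nat R.

Lemma product_uniform01E (A : set nat) y :
  (Q \x uniform_prob (@ltr01 R))%E (A `*` [set v | clamp v <= y]) =
  (Q A * (clamp y)%:E)%E.
Proof.
rewrite (product_measure1E _ _ _ (@measurable_clamp_le R y))//.
by rewrite -uniform01_clamp.
Qed.

Lemma cdf_shifted_clamp (p : R) : Q K = p%:E ->
  cdf (shifted_clamp : {RV (Q \x uniform_prob (@ltr01 R))%E >-> R}) =
  fun x => (p * clamp x + (1 - p) * clamp (x - 1))%:E.
Proof.
move=> QK; apply/funext => x; rewrite /cdf /distribution /pushforward.
pose B y : set (measurableTypeR R) := [set v | clamp v <= y].
have -> : shifted_clamp @^-1` `]-oo, x] = K `*` B x `|` ~` K `*` B (x - 1).
  apply/seteqP; split=> -[k v] /=; rewrite in_itv/= /shifted_clamp/B/=.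
    have [kK|kK] := boolP (k \in K); rewrite ?addr0 => vx.
      by left; rewrite inE in kK.
    by right; split; [rewrite notin_setE in kK|rewrite lerBrDr].
  case=> -[kK vx]; first by rewrite (mem_set kK) addr0.
  by rewrite (memNset kK) -lerBrDr.
rewrite measureU; last 3 first.
- by apply: measurableX => //; exact: measurable_clamp_le.
- by apply: measurableX => //; exact: measurable_clamp_le.
- by apply/seteqP; split=> -[k v] //= [[]] ? ? [].
rewrite EFinD !EFinM EFinB -QK -probability_setC//.
by congr (_ + _)%E; exact: product_uniform01E.
Qed.

End shifted_clamp.

(** All coordinates have the same distribution function, which is [p x] on
    [[0, 1]] and at least [p] beyond.  Hence for [u < p] the joint tail event
    of [i] and [j] is exactly: the random set contains both, and the uniform
    value is at most [u / p].  The tail ratio is thus constant near 0. *)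
Lemma TDM_of_random_set (R : realType) (d : nat) (Q : probability nat R)
    (K : 'I_d -> set nat) (p : R) (M : 'M[R]_d) :
  0 < p -> (forall i, Q (K i) = p%:E) ->
  (forall i j, Q (K i `&` K j) = (p * M i j)%:E) -> TDM M.
Proof.
move=> p0 QK QKK.
exists _, _, (Q \x uniform_prob (@ltr01 R))%E.
pose X i : {RV (Q \x uniform_prob (@ltr01 R))%E >-> R} := shifted_clamp (K i).
exists X; split=> [i|i j].
  rewrite (cdf_shifted_clamp (QK i)) => x.
  apply: cvg_EFin; first exact: nearW.
  apply: cvgD; apply: cvgMl_tmp; first exact: continuous_clamp.
  apply: (cvg_comp (fun y => y - 1)); last exact: continuous_clamp.
  by apply: cvgB; [exact: cvg_id | exact: cvg_cst].
apply: cvg_near_cst; near=> u.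
have u0 : 0 < u by [].
have up : u < p by near: u; exact: nbhs_right_lt.
have cdfE l k v : (cdf (X l) (X l (k, v)) <= u%:E)%E =
    (k \in K l) && (clamp v <= u / p).
  rewrite (cdf_shifted_clamp (QK l)) lee_fin /X/= /shifted_clamp/=.
  have /andP[v0 v1] := clamp_itv v.
  case: (k \in K l); rewrite /= ?mulr0n ?mulr1n.
    rewrite addr0 clamp_id ?v0// (@clamp_le0 _ (_ - 1)) ?subr_le0//.
    by rewrite mulr0 addr0 ler_pdivlMr// mulrC.
  rewrite clamp_ge1 ?lerDr// addrK clamp_id ?v0// mulr1.
  apply/negbTE; rewrite -ltNge (lt_le_trans up)// lerDl mulr_ge0// subr_ge0.
  by rewrite -lee_fin -(QK l) probability_le1.
rewrite /tail_ratio.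
pose B : set (measurableTypeR R) := [set v | clamp v <= u / p].
have -> : [set w | (cdf (X i) (X i w) <= u%:E)%E /\
    (cdf (X j) (X j w) <= u%:E)%E] = (K i `&` K j) `*` B.
  apply/seteqP; split=> -[k v].
    move=> [ci cj].
    have /andP[/set_mem ki vB] := etrans (esym (cdfE i k v)) ci.
    by have /andP[/set_mem kj _] := etrans (esym (cdfE j k v)) cj.
  move=> [[/mem_set ki /mem_set kj] vB]; split.
    by apply: etrans (cdfE i k v) _; rewrite ki.
  by apply: etrans (cdfE j k v) _; rewrite kj.
have PE : (Q \x uniform_prob (@ltr01 R))%E ((K i `&` K j) `*` B) =
    (p * M i j * (u / p))%:E.
  apply: etrans (product_uniform01E _ _ _) _; rewrite QKK clamp_id//.
  by rewrite ltW ?divr_gt0//= ler_pdivrMr// mul1r ltW.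
transitivity (p * M i j * (u / p) / u).
  by congr (_ / u); exact: (congr1 fine PE).
by field; rewrite !gt_eqF.
Unshelve. all: by end_near. Qed.

Lemma mnormalize_finE (disp : measure_display) (T : measurableType disp)
    (R : realType) (mu : {measure set T -> \bar R}) (P : probability T R)
    (W : R) (A : set T) :
  mu setT = W%:E -> 0 < W -> mnormalize mu P A = (W^-1%:E * mu A)%E.
Proof.
move=> muT W0; rewrite /mnormalize muT eqe gt_eqF//=.
by rewrite muleC.
Qed.

Section weighted_index.
Variables (R : realType) (n : nat) (w : nat -> {nonneg R}).

Definition weighted_index : probability nat R :=
  mnormalize (msum (fun k => mscale (w k) (dirac k)) n) (dirac 0%N).

Lemma weighted_indexE (A : set nat) : 0 < \sum_(k < n) (w k)%:num ->
  weighted_index A = ((\sum_(k < n) (w k)%:num)^-1 *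
    \sum_(k < n) (w k)%:num * ((k : nat) \in A)%:R)%:E.
Proof.
set W := \sum_(k < n) _ => W0.
have mE (B : set nat) : msum (fun k => mscale (w k) (dirac k)) n B =
    (\sum_(k < n) (w k)%:num * ((k : nat) \in B)%:R)%:E.
  rewrite /msum -sumEFin; apply: eq_bigr => k _.
  by rewrite EFinM -indicE.
have mT : msum (fun k => mscale (w k) (dirac k)) n [set: nat] = W%:E.
  by rewrite mE; congr EFin; apply: eq_bigr => k _; rewrite in_setT mulr1.
rewrite EFinM -mE; exact: mnormalize_finE mT W0.
Qed.

End weighted_index.

(** The unit diagonal says that every index is in the random set with the same
    probability, the inverse of the total weight; conditioning on [i] being in
    the set then undoes the normalization of the weights. *)
Lemma TDM_of_weighted_sets (R : realType) (d : nat) (M : 'M[R]_d)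
    (s : seq ({nonneg R} * pred 'I_d)) :
  (forall i, M i i = 1) ->
  (forall i j, M i j = \sum_(x <- s) x.1%:num * (x.2 i && x.2 j)%:R) ->
  TDM M.
Proof.
move=> M1 ME.
pose x0 : {nonneg R} * pred 'I_d := (NngNum (lexx 0), fun=> false).
pose w k := (nth x0 s k).1.
pose K i : set nat := [set k | (nth x0 s k).2 i].
pose W := \sum_(k < size s) (w k)%:num.
have W0 (i : 'I_d) : 0 < W.
  apply: lt_le_trans ltr01 _; rewrite -(M1 i) ME (big_nth x0) big_mkord.
  by apply: ler_sum => k _; rewrite ler_piMr//; case: (_ && _).
have QKK i j : weighted_index (size s) w (K i `&` K j) = (W^-1 * M i j)%:E.
  rewrite weighted_indexE ?(W0 i)// ME (big_nth x0) big_mkord.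
  congr (_ * _)%:E; apply: eq_bigr => k _; congr (_ * _%:R).
  by rewrite in_setI /K /in_mem /=; congr (nat_of_bool (_ && _)); exact: asboolb.
(* In dimension 0 the total weight can vanish, but there is nothing to check. *)
case: d => [|d] in M s M1 ME x0 w K W W0 QKK *.
  by apply: (@TDM_of_random_set R 0 (dirac 0%N) (fun=> set0) 1) => //; case.
apply: (@TDM_of_random_set _ _ (weighted_index (size s) w) K W^-1) => //.
  by rewrite invr_gt0 (W0 ord0).
by move=> i; rewrite -[K i]setIid QKK M1 mulr1.
Qed.

(** * Decomposition of the Toeplitz matrix *)

(** For each [i < d] the window [m |-> i + 3 - m] runs over [1, 2, 3] well inside
    the range of [m]: the boundary of the index set is not felt.  When
    [m >= i + 3] the truncated subtraction gives 0, hence the condition on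
    [f 0]. *)
Lemma sum_window (R : realType) (d i : nat) (f : nat -> R) :
  (i < d)%N -> f 0 = 0 -> (forall k, (3 < k)%N -> f k = 0) ->
  \sum_(0 <= m < d.+2) f (i + 3 - m)%N = f 1 + f 2 + f 3.
Proof.
move=> id f0 f4.
rewrite (big_cat_nat (n := i))//=; last by lia.
rewrite (big_cat_nat (m := i) (n := i.+3))//=; last by lia.
rewrite big_nat_cond big1 ?add0r; last first.
  by move=> m /andP[mi _]; rewrite f4//; lia.
rewrite [X in _ + X]big_nat_cond [X in _ + X]big1 ?addr0; last first.
  by move=> m /andP[mi _]; rewrite [(_ - _)%N](_ : _ = 0)//; lia.
rewrite -{1}[i]add0n big_addn (_ : i.+3 - i = 3)%N; last by lia.
rewrite 3?big_nat_recl// big_geq// addr0 add0n.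
rewrite (_ : i + 3 - i = 3)%N; last by lia.
rewrite (_ : i + 3 - (1 + i) = 2)%N; last by lia.
rewrite (_ : i + 3 - (2 + i) = 1)%N; last by lia.
ring.
Qed.

(** The range of [m] covers every translate of a pattern [A] included in
    [{1,2,3}] that meets the index set, including those that stick out of it. *)
Definition translates (R : realType) (d : nat) (c : {nonneg R}) (A : seq nat) :
    seq ({nonneg R} * pred 'I_d) :=
  [seq (c, fun i : 'I_d => (i + 3 - m)%N \in A) | m <- index_iota 0 d.+2].

(** The number of translates of [A] containing both [i] and [j] is the number
    of pairs of elements of [A] with difference [j - i]. *)
Lemma sum_translates (R : realType) (d : nat) (c : {nonneg R}) (A : seq nat)
    (i j : 'I_d) : (i <= j)%N -> all (fun k => 0 < k <= 3)%N A ->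
  \sum_(x <- translates d c A) x.1%:num * (x.2 i && x.2 j)%:R =
  c%:num * (\sum_(1 <= k < 4) ((k \in A) && ((k + (j - i))%N \in A)))%N%:R.
Proof.
move=> ij /allP A13; rewrite big_map /= -mulr_sumr; congr (_ * _).
pose f k : R := ((k \in A) && ((k + (j - i))%N \in A))%:R.
rewrite (eq_bigr (fun m => f (i + 3 - m)%N)) => [|m _]; last first.
  rewrite /f; have [/[dup] im /A13/= im0|//] := boolP ((i + 3 - m)%N \in A).
  by rewrite (_ : i + 3 - m + (j - i) = j + 3 - m)%N//; lia.
rewrite sum_window//.
- by rewrite natr_sum 3?big_nat_recl// big_geq// addr0 addrA.
- by rewrite /f; have [/A13|] := boolP (0%N \in A).
- by move=> k k3; rewrite /f; have [/A13|//] := boolP (k \in A); lia.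
Qed.

Lemma toeplitz_TDM (R : realType) (d : nat) (alpha beta : R) :
  0 <= alpha -> 0 <= beta -> alpha + 4 * beta <= 2 -> 2 * alpha - beta <= 1 ->
  TDM (toeplitz d alpha beta).
Proof.
move=> a0 b0 ab2 ab1.
(* The least weight t of the triples that keeps the weight of the singletons
   nonnegative. *)
have [t [t0 ta tb s0]] : exists t : R,
    [/\ 0 <= t, 0 <= alpha - 2 * t, 0 <= beta - t &
        0 <= 1 - 2 * alpha - 2 * beta + 3 * t].
  have [h|h] := leP (2 * alpha + 2 * beta) 1; first by exists 0; split; lra.
  by exists ((2 * alpha + 2 * beta - 1) / 3); split; lra.
apply: (@TDM_of_weighted_sets _ _ _
  (translates d (NngNum s0) [:: 1%N] ++ translates d (NngNum ta) [:: 1%N; 2] ++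
   translates d (NngNum tb) [:: 1%N; 3] ++
   translates d (NngNum t0) [:: 1%N; 2; 3])).
  by move=> i; rewrite toeplitzE// subnn.
move=> i j; wlog ij : i j / (i <= j)%N.
  move=> H; have [/H//|/ltnW/H] := leqP i j.
  by rewrite toeplitz_sym => ->; apply: eq_bigr => x _; rewrite andbC.
rewrite toeplitzE// !big_cat !sum_translates//=.
(* Distances 0, 1, 2 and at least 3, the pattern counts being computed. *)
by move: (j - i)%N => [|[|[|k]]]; rewrite unlock /= ?inE/=; ring.
Qed.

Theorem proposition4p2 (R : realType) (d : nat) (hd : (6 <= d)%N)
    (alpha beta : R) :
  TDM (toeplitz d alpha beta) <->
  [/\ 0 <= alpha, 0 <= beta, alpha + 4 * beta <= 2 & 2 * alpha - beta <= 1].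
Proof.
split; first exact: TDM_toeplitz_bounds.
by case; exact: toeplitz_TDM.
Qed.
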